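(* Let $d=1$ and let $V=V_0+V_1$ satisfy the assumptions in the context. Then the effective diffusion coefficient $\mathcal{M}(x)$ defined in the context is given by $$\mathcal{M}(x)=\frac{1}{Z_1(x)\,\widehat{Z}_1(x)},\qquad x\in\mathbb{R},$$ where $$Z_1(x)=\int_{\mathbb{T}}\cdots\int_{\mathbb{T}}e^{-V_1(x,x_1,\ldots,x_N)/\sigma}\,dx_1\cdots dx_N,\qquad \widehat{Z}_1(x)=\int_{\mathbb{T}}\cdots\int_{\mathbb{T}}e^{V_1(x,x_1,\ldots,x_N)/\sigma}\,dx_1\cdots dx_N .$$
   Context: Fix an integer $N\ge1$ and $\sigma>0$; $\mathbb{T}=\mathbb{R}/\mathbb{Z}$ has length $1$. Assumptions: $V:\mathbb{R}\times\mathbb{T}^N\to\mathbb{R}$ is smooth and $V(x_0,\ldots,x_N)=V_0(x_0)+V_1(x_0,x_1,\ldots,x_N)$, where $V_0$ is smooth, $e^{-V_0}\in L^1(\mathbb{R})$, $V_0(x)\to\infty$ as $|x|\to\infty$, $V_0''$ is bounded, and $V_1$ is smooth and uniformly bounded. Effective diffusion coefficient (in dimension $1$): set $\mathcal{K}_N=e^{-V(x_0,\ldots,x_N)/\sigma}$. Recursively for $k=N,\ldots,1$: $\theta_k(x_0,\ldots,x_{k-1},\cdot)\in H^1(\mathbb{T})$ is the solution, unique up to an additive constant, of $\partial_{x_k}\big(\mathcal{K}_k(\partial_{x_k}\theta_k+1)\big)=0$ on $\mathbb{T}$, where for $k\le N-1$ $$\mathcal{K}_k(x_0,\ldots,x_k)=\int_{\mathbb{T}^{N-k}}(1+\partial_{x_N}\theta_N)\cdots(1+\partial_{x_{k+1}}\theta_{k+1})e^{-V/\sigma}\,dx_N\cdots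 dx_{k+1}.$$ With $Z(x)=\int_{\mathbb{T}^N}e^{-V(x,x_1,\ldots,x_N)/\sigma}\,dx_N\cdots dx_1$, $$\mathcal{M}(x)=\frac{1}{Z(x)}\int_{\mathbb{T}^N}(1+\partial_{x_N}\theta_N)\cdots(1+\partial_{x_1}\theta_1)e^{-V(x,x_1,\ldots,x_N)/\sigma}\,dx_N\cdots dx_1 .$$ *)

(* Defs.v *)
From HB Require Import structures.
From mathcomp Require Import all_boot all_order all_algebra.
From mathcomp Require Import all_classical all_reals all_analysis.
Set Implicit Arguments.
Unset Strict Implicit.
Unset Printing Implicit Defensive.
Import Order.TTheory GRing.Theory Num.Theory.
Import numFieldNormedType.Exports.
Local Open Scope classical_set_scope.
Local Open Scope ring_scope.

(* Iterated directional derivative, applied along the directions in s. *)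
Definition iter_derive (R : realType) (U : normedModType R) (s : seq U)
    (f : U -> R) : U -> R :=
  foldr (fun v g => 'D_v g) f s.

Definition smooth (R : realType) (U : normedModType R) (f : U -> R) : Prop :=
  forall s : seq U,
    continuous (iter_derive s f) /\
    (forall x v, derivable (iter_derive s f) x v).

(* A function on R x T^(n-1), T = R/Z, is represented by a function on R^n that
   is 1-periodic in every coordinate except the one of index 0. *)
Definition torus_fun (R : realType) (n : nat) (A : Type) (f : 'rV[R]_n -> A) :=
  forall i : 'I_n, (0 < i)%N -> forall x, f (x + delta_mx 0 i) = f x.

Definition integral_torus (R : realType) (u : R -> R) : R :=
  (\int[@lebesgue_measure R]_(t in `[0, 1]) u t)%R.

Definition L2_torus (R : realType) (u : R -> R) : Prop :=
  [/\ periodic u 1,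
      measurable_fun (`[0, 1] : set R) u
    & (@lebesgue_measure R).-integrable `[0, 1] (fun t => (u t ^+ 2)%:E)].

Definition weak_derivative (R : realType) (u g : R -> R) : Prop :=
  forall phi : R -> R, smooth phi -> periodic phi 1 ->
    integral_torus (fun t => u t * (phi^`())%classic t) =
    - integral_torus (fun t => g t * phi t).

(* u is in H^1(T), and g is a representative of its weak derivative, which is
   only determined almost everywhere. *)
Definition H1_torus (R : realType) (u g : R -> R) : Prop :=
  [/\ L2_torus u, L2_torus g & weak_derivative u g].

(* Variational form of (K (u' + 1))' = 0 on T for u in H^1(T) with weak
   derivative du; the test functions range over H^1(T). *)
Definition cell_problem (R : realType) (K u du : R -> R) : Prop :=
  H1_torus u du /\
  forall phi dphi : R -> R, H1_torus phi dphi ->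
    integral_torus (fun t => K t * (du t + 1) * dphi t) = 0.

(* A point (x_0, ..., x_N) is a row vector x, and coordinates are indexed by
   natural numbers k <= N. *)
Definition coordinate (R : realType) (N : nat) (x : 'rV[R]_N.+1) (k : nat) : R :=
  x 0 (inord k).

(* (x_0, ..., x_(k-1)), used for k <= N only *)
Definition first_coordinates (R : realType) (N k : nat) (x : 'rV[R]_N.+1) :
    'rV[R]_k :=
  \row_(i < k) coordinate x i.

Definition set_coordinate (R : realType) (N : nat) (x : 'rV[R]_N.+1) (k : nat)
    (t : R) : 'rV[R]_N.+1 :=
  \row_(i < N.+1) (if i == k :> nat then t else x 0 i).

(* Iterated integral over T of f with respect to the variables x_k, k in s. The
   head of s is the outermost variable. The result is seen as a function of all
   the variables, constant in the integrated ones. *)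
Definition iter_integral (R : realType) (N : nat) (s : seq nat)
    (f : 'rV[R]_N.+1 -> R) : 'rV[R]_N.+1 -> R :=
  foldr (fun k g x => integral_torus (fun t => g (set_coordinate x k t))) f s.

Section EffectiveDiffusion.
Variables (R : realType) (N : nat) (sigma : R) (V : 'rV[R]_N.+1 -> R).
(* dtheta k (x_0, ..., x_(k-1)) x_k is the derivative of theta_k in x_k. *)
Variable dtheta : forall k : nat, 'rV[R]_k -> R -> R.

(* For k = N the product and the integral are empty, and K_N = exp(- V / sigma).
   For k = 0 this is the integral in the definition of M. *)
Definition calK (k : nat) : 'rV[R]_N.+1 -> R :=
  iter_integral (iota k.+1 (N - k)) (fun x =>
    (\prod_(k.+1 <= j < N.+1)
       (1 + dtheta (first_coordinates j x) (coordinate x j))) *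
    expR (- V x / sigma)).

Definition corrector_family (theta : forall k : nat, 'rV[R]_k -> R -> R) :=
  forall k : nat, (1 <= k <= N)%N ->
    [/\ torus_fun (@theta k), torus_fun (@dtheta k)
      & forall x : 'rV[R]_N.+1,
          cell_problem (fun t => calK k (set_coordinate x k t))
            (theta k (first_coordinates k x))
            (dtheta (first_coordinates k x))].

(* const_mx x is only a base point whose coordinate of index 0 is x: the other
   coordinates are integrated out. *)
Definition partition_fun (x : R) : R :=
  iter_integral (iota 1 N) (fun y => expR (- V y / sigma)) (const_mx x).

Definition effective_diffusion (x : R) : R :=
  calK 0 (const_mx x) / partition_fun x.

End EffectiveDiffusion.

(* Here x_1 is the innermost variable and x_N the outermost one. *)
Definition Z1 (R : realType) (N : nat) (sigma : R) (V1 : 'rV[R]_N.+1 -> R)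
    (x : R) : R :=
  iter_integral (rev (iota 1 N)) (fun y => expR (- V1 y / sigma)) (const_mx x).

Definition Z1hat (R : realType) (N : nat) (sigma : R) (V1 : 'rV[R]_N.+1 -> R)
    (x : R) : R :=
  iter_integral (rev (iota 1 N)) (fun y => expR (V1 y / sigma)) (const_mx x).

(* Main.v *)
Require Import Defs.
From mathcomp Require Import all_boot all_order all_algebra.
From mathcomp Require Import all_classical all_reals all_analysis.
From mathcomp Require Import measurable_realfun.
From mathcomp Require Import ring lra.
Import Order.TTheory GRing.Theory Num.Theory.
Import numFieldNormedType.Exports.
Local Open Scope classical_set_scope.
Local Open Scope ring_scope.

(* For a positive continuous periodic K with m the mean of 1 / K, the function
   1 / K - m has a periodic primitive, so it may be used as the derivative of a
   test function in the cell problem. Since 1 + theta' has mean 1, this gives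
   that the mean of K (1 + theta') is 1 / m. By descending induction on k, with
   1 + d theta_k taken out of the inner integrals, 1 / K_k is the integral of
   exp (V / sigma) over x_(k+1), ..., x_N. For k = 0 the factors
   exp (V_0 / sigma) and exp (- V_0 / sigma) cancel, and Fubini's theorem
   reverses the order of integration. *)

(** * Integrals of continuous functions over the circle *)

Section TorusIntegral.
Variable R : realType.
Implicit Types f g K u du : R -> R.
Local Notation mu := (@lebesgue_measure R).
Local Notation I01 := (`[0, 1]%classic : set R).

Lemma continuous_integrable01 f : continuous f -> mu.-integrable I01 (EFin \o f).
Proof.
move=> cf; apply: continuous_compact_integrable; first exact: segment_compact.
exact: continuous_subspaceT.
Qed.

Lemma integral_torus_cst (c : R) : integral_torus (fun=> c) = c.
Proof.
rewrite /integral_torus Rintegral_cst//.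
rewrite -[RHS]mulr1; congr (_ * _).
transitivity (fine (mu [set` `[0%R, 1%R]])) => //.
by rewrite lebesgue_measure_itv/= lte_fin ltr01 -EFinB subr0.
Qed.

Lemma integral_torus_gt0 f : continuous f -> (forall t, 0 < f t) ->
  0 < integral_torus f.
Proof.
(* The minimum over the compact interval is attained, hence positive, and it bounds the integral
   from below since the interval has length 1. *)
move=> cf f0; have [c _ fc] := EVT_min ler01 (continuous_subspaceT cf (A := I01)).
apply: (lt_le_trans (f0 c)); rewrite -[X in X <= _]integral_torus_cst.
apply: le_Rintegral => //; first exact/continuous_integrable01/cst_continuous.
exact: continuous_integrable01.
Qed.

Lemma continuous_pairl (T U V : topologicalType) (f : T * U -> V) (x : T) :
  continuous f -> continuous (fun y => f (x, y)).
Proof.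
move=> cf y; apply: (@cvg_comp _ _ _ (fun z => (x, z)) f); last exact: cf.
by apply: cvg_pair; [exact: cvg_cst|exact: cvg_id].
Qed.

Lemma continuous_pairr (T U V : topologicalType) (f : T * U -> V) (y : U) :
  continuous f -> continuous (fun x => f (x, y)).
Proof.
move=> cf x; apply: (@cvg_comp _ _ _ (fun z => (z, y)) f); last exact: cf.
by apply: cvg_pair; [exact: cvg_id|exact: cvg_cst].
Qed.

Lemma cvg_floor_div (s : R) : (Num.floor (n.+1%:R * s))%:~R / n.+1%:R @[n --> \oo] --> s.
Proof.
apply/cvgrPdist_lt => e e0; near=> n.
have n0 : 0 < n.+1%:R :> R by [].
have /andP[h1 h2] := floor_itv (n.+1%:R * s).
rewrite intrD mulr1z in h2.
rewrite ger0_norm; last by rewrite subr_ge0 ler_pdivrMr// [s * _]mulrC.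
rewrite ltrBlDr -ltrBlDl ltr_pdivlMr// mulrBl.
suff : 1 < e * n.+1%:R by rewrite [s * _]mulrC; lra.
by rewrite -ltr_pdivrMr// mul1r; near: n; exact: near_infty_natSinv_lt (PosNum e0).
Unshelve. all: by end_near. Qed.

(** Measurability refers to the product sigma-algebra. Rounding the first variable down to the grid
    of mesh [1 / n.+1] gives functions for which preimages of measurable sets are countable unions
    of rectangles; these functions converge pointwise to [f]. *)
Lemma continuous_measurable_fun2 (f : R * R -> R) : continuous f ->
  measurable_fun setT f.
Proof.
move=> cf.
apply: (@measurable_fun_cvg _ (R * R)%type R setT
  (fun n z => f ((Num.floor (n.+1%:R * z.1))%:~R / n.+1%:R, z.2)) f) => [n|z _].
- move=> _ Y mY; rewrite setTI.
  rewrite (_ : _ @^-1` Y = \bigcup_(k : int)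
    (`[k%:~R / n.+1%:R, (k + 1)%:~R / n.+1%:R[%classic `*`
     ((fun t => f (k%:~R / n.+1%:R, t)) @^-1` Y))).
    apply: countable_bigcupT_measurable; first exact: countableP.
    move=> k; apply: measurableX; first exact: measurable_itv.
    rewrite -[X in measurable X]setTI; apply: continuous_measurable_fun => //.
    exact: continuous_pairl.
  have n0 : 0 < n.+1%:R :> R by [].
  have itvE (k : int) (s : R) :
      (s \in `[k%:~R / n.+1%:R, (k + 1)%:~R / n.+1%:R[) = (k == Num.floor (n.+1%:R * s)).
    by rewrite in_itv/= ler_pdivrMr// ltr_pdivlMr// [s * _]mulrC -floor_eq eq_sym.
  apply/seteqP; split => -[s t] /=.
    by move=> fst; exists (Num.floor (n.+1%:R * s)) => //; split => //=; rewrite itvE.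
  by move=> [k _ /= []]; rewrite itvE => /eqP ->.
- apply: (@cvg_comp _ _ _
    (fun n => ((Num.floor (n.+1%:R * z.1))%:~R / n.+1%:R, z.2)) f); last exact: cf.
  case: z => s t /=; exact: (cvg_pair (cvg_floor_div s) (cvg_cst t)). 
Qed.

(** Tonelli's theorem on the plane, applied to the extension [F] of [f] by zero outside the unit
    square. *)
Lemma integral_torus_fubini (f : R * R -> R) : continuous f -> (forall z, 0 <= f z) ->
  integral_torus (fun s => integral_torus (fun t => f (s, t))) =
  integral_torus (fun t => integral_torus (fun s => f (s, t))).
Proof.
move=> cf f0.
have c1 s : continuous (fun t => f (s, t)).
  exact: continuous_pairl.
have c2 t : continuous (fun s => f (s, t)).
  exact: continuous_pairr.
rewrite /integral_torus; congr fine.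
(* Finiteness of the inner integrals lets the iterated real integrals be read as iterated
   extended-real ones. *)
have fin g : continuous g -> (\int[mu]_(t in I01) (g t)%:E)%E \is a fin_num.
  by move=> cg; apply: integrable_fin_num => //; exact: continuous_integrable01.
under eq_integral => s _ do rewrite fineK ?fin//.
under [RHS]eq_integral => t _ do rewrite fineK ?fin//.
have m01 : measurable I01 by exact: measurable_itv.
have m2 := measurableX m01 m01.
pose F : R * R -> \bar R := (EFin \o f) \_ (I01 `*` I01).
have mF : measurable_fun setT F.
  apply/(@measurable_restrictT _ _ (R * R)%type (\bar R) _ (EFin \o f) m2).
  apply/measurable_EFinP; exact: (measurable_funTS (continuous_measurable_fun2 f cf)).
have F0 z : (0 <= F z)%E.
  by rewrite /F patchE; case: ifP => // _; rewrite lee_fin.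
have := @fubini_tonelli _ _ _ _ _ mu mu F mF F0.
congr (_ = _).
- rewrite [RHS]integral_mkcond; apply: eq_integral => s _; rewrite patchE.
  case: ifPn => sI; last first.
    apply: integral0_eq => t _; rewrite /F patchE ifF//; apply/negbTE.
    by move: sI; apply: contra; rewrite !inE => -[].
  rewrite [RHS]integral_mkcond; apply: eq_integral => t _; rewrite /F !patchE.
  congr (if _ then _ else _).
  apply/idP/idP; rewrite !inE; first by case.
  by move=> tI; split => //; rewrite inE in sI.
- rewrite [RHS]integral_mkcond; apply: eq_integral => t _; rewrite patchE.
  case: ifPn => tI; last first.
    apply: integral0_eq => s _; rewrite /F patchE ifF//; apply/negbTE.
    by move: tI; apply: contra; rewrite !inE => -[].
  rewrite [RHS]integral_mkcond; apply: eq_integral => s _; rewrite /F !patchE.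
  congr (if _ then _ else _).
  apply/idP/idP; rewrite !inE; first by case.
  by move=> sI; split => //; rewrite inE in tI.
Qed.

(** By compactness of [[0, 1]], continuity at the points [(x, t)] is uniform in [t]: one
    neighbourhood of [x] serves all [t]. *)
Lemma continuous_integral_torus (T : topologicalType) (f : T * R -> R) :
  continuous f -> continuous (fun x => integral_torus (fun t => f (x, t))).
Proof.
move=> cf x; apply/cvgrPdist_le => e e0.
have c1 y : continuous (fun t => f (y, t)).
  exact: continuous_pairl.
have := (compact_near_coveringP I01).1 (segment_compact (a := 0) (b := 1)).
move=> /(_ _ (nbhs x) (fun y t => `|f (x, t) - f (y, t)| <= e)) => /(_ _) cov.
have {}cov : \forall y \near x, I01 `<=` (fun t => `|f (x, t) - f (y, t)| <= e).
  apply: cov => t _.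
  have e2 : 0 < e / 2 by rewrite divr_gt0.
  have := cf (x, t) => /cvgrPdist_le /(_ _ e2) [[A B] /= [xA tB] AB].
  have := c1 x t => /cvgrPdist_le /(_ _ e2) tC.
  exists (B `&` [set t' | `|f (x, t) - f (x, t')| <= e / 2], A).
    by split => //=; apply: filterI.
  move=> [t' y] [/= [Bt' h1] Ay]; have := AB (y, t') (conj Ay Bt') => /= h2.
  rewrite (_ : _ - _ = - (f (x, t) - f (x, t')) + (f (x, t) - f (y, t'))); last by ring.
  by rewrite (le_trans (ler_normD _ _))// normrN (splitr e) lerD.
near=> y.
rewrite /integral_torus -RintegralB//; [|exact: continuous_integrable01..].
have cB : continuous (fun t => f (x, t) - f (y, t)).
  by move=> t; apply: cvgB; exact: c1.
apply: (le_trans (le_normr_Rintegral _ _)) => //; first exact: continuous_integrable01.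
rewrite -[leRHS](@integral_torus_cst e); apply: le_Rintegral => //.
- by apply: continuous_integrable01 => t; apply: cvg_norm; exact: cB.
- exact/continuous_integrable01/cst_continuous.
- by near: y.
Unshelve. all: by end_near. Qed.

(** * Square-integrable and Sobolev functions on the circle *)

Lemma L2_torus_integrable f : L2_torus f -> mu.-integrable I01 (EFin \o f).
Proof.
move=> [_ mf if2].
apply: (@le_integrable _ _ _ mu I01 _ _ (fun t => (1 + f t ^+ 2)%:E)) => //.
- exact/measurable_EFinP.
- move=> t _ /=; rewrite lee_fin [leRHS]ger0_norm ?addr_ge0 ?sqr_ge0//.
  rewrite -(real_normK (num_real (f t))).
  (* With [y = |f t|], the inequality [(y - 1/2)^2 >= 0] gives [y <= y^2 + 1/4 <= 1 + y^2]. *)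
  by have := sqr_ge0 (`|f t| - 2^-1); move: `|f t| => y; nra.
- apply: (@integrableD _ _ _ mu I01 _ (EFin \o cst 1) (fun t => (f t ^+ 2)%:E)) => //.
  exact/(@continuous_integrable01 (cst 1))/cst_continuous.
Qed.

Lemma integrable01M_continuous f K : continuous K ->
  mu.-integrable I01 (EFin \o f) -> mu.-integrable I01 (EFin \o (K \* f)).
Proof.
move=> cK fi.
have := @integrableMr _ _ _ mu I01 _ K (EFin \o f); apply => //.
- apply: measurable_funTS; exact: continuous_measurable_fun.
- have [K1 K1P] := compact_bounded (continuous_compact
    (continuous_subspaceT cK (A := I01)) (segment_compact (a := 0) (b := 1))).
  exists K1; split; first exact: K1P.1.
  move=> x /K1P.2 h t t01 /=; apply: h; by exists t.
Qed.

(** The primitive from 0, extended periodically from [[0, 1]], has the required properties: since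
    [f] has mean zero, it vanishes at both ends, so the boundary terms in the integration by parts
    vanish. *)
Lemma H1_torus_primitive f : continuous f -> periodic f 1 ->
  integral_torus f = 0 -> exists phi, H1_torus phi f.
Proof.
move=> cf fP f0.
pose F x := \int[mu]_(t in `[0, x]) f t.
pose phi t := F (t - (Num.floor t)%:~R).
have F0 : F 0 = 0 by rewrite /F set_itv1 Rintegral_set1.
have phiF : {in I01, phi =1 F}.
  move=> t; rewrite inE/= in_itv/= => /andP[t0]; rewrite le_eqVlt.
  (* At [t = 1] the fractional part is 0, so [phi 1 = F 0 = 0], and this is [F 1] because [f] has
     mean zero. *)
  case/predU1P => [->|t1]; first by rewrite /phi floor1 subrr F0 -f0.
  by rewrite /phi (_ : Num.floor t = 0) ?subr0//; apply: floor_def; rewrite t0.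
have dF x : 0 < x -> derivable F x 1 /\ (F^`())%classic x = f x.
  (* The end point [x + 1] only serves to make [x] interior to the interval of integrability. *)
  move=> x0; apply: (@continuous_FTC1 R f (BLeft 0) x (x + 1)) => //.
  - by rewrite ltrDl.
  - by apply: continuous_compact_integrable;
      [exact: segment_compact|exact: continuous_subspaceT].
  - exact: cf.
have cF : {within I01, continuous F}.
  by apply: parameterized_integral_continuous => //; exact: continuous_integrable01.
have L2 (g h : R -> R) : {within I01, continuous h} ->
    {in I01, g =1 h} -> periodic g 1 -> L2_torus g.
  move=> ch gh gP; have mh : measurable_fun I01 h.
    exact: subspace_continuous_measurable_fun.
  split => //.
  - by apply: eq_measurable_fun mh => t /gh ->.
  - apply: (@eq_integrable _ _ _ mu I01 _ (EFin \o (fun t => h t ^+ 2))) => //.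
      by move=> t /gh /= ->.
    apply: continuous_compact_integrable; first exact: segment_compact.
    by move=> t; apply: cvgM; exact: ch.
exists phi; split.
- apply: (L2 _ F) => // t; rewrite /phi floorDrz ?int_num1//.
  by rewrite floor1 intrD opprD addrACA subrr addr0.
- exact: (L2 _ f) (continuous_subspaceT cf) _ _.
- move=> psi psis psiP.
  rewrite /integral_torus.
  rewrite (@eq_Rintegral _ _ _ mu I01 (fun t => F t * (psi^`())%classic t)); last first.
    by move=> t /phiF ->.
  have [cpsi dpsi] := psis [::]; have [cdpsi _] := psis [:: 1].
  have dcdpsi : continuous (psi^`())%classic.
    rewrite (_ : (psi^`())%classic = 'D_1 psi); first exact: cdpsi.
    by apply/funext => t; rewrite derive1E.
  rewrite (@Rintegration_by_parts _ F psi f (psi^`())%classic) //.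
  + have -> : F 1 = 0 by exact: f0.
    by rewrite F0 !mul0r subrr sub0r.
  + exact: continuous_subspaceT.
  + have /continuous_within_itvP := cF => /(_ ltr01)[_ c0 c1].
    by split => // t; rewrite in_itv/= => /andP[t0 _]; exact: (dF _ t0).1.
  + by move=> t; rewrite in_itv/= => /andP[t0 _]; exact: (dF _ t0).2.
  + exact: continuous_subspaceT.
  + split=> [t _||]; first exact: dpsi.
      exact/cvg_at_right_filter/cpsi.
    exact/cvg_at_left_filter/cpsi.
Qed.

Lemma smooth_cst (c : R) : smooth (cst c : R -> R).
Proof.
have cstE (s : seq R) : exists d : R, iter_derive s (cst c : R -> R) = cst d.
  elim: s => [|v s [d ds]]; first by exists c.
  exists 0; rewrite /= ds; apply/funext => t; exact: derive_cst.
move=> s; have [d ->] := cstE s; split; first exact: cst_continuous.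
by move=> x v; exact: derivable_cst.
Qed.

(** The constant 1 is an admissible test function, and its derivative vanishes. *)
Lemma integral_weak_derivative u du : weak_derivative u du -> integral_torus du = 0.
Proof.
move=> /(_ _ (smooth_cst 1)) /(_ (fun=> erefl)).
rewrite /integral_torus.
under eq_Rintegral do rewrite derive1_cst mulr0.
rewrite [X in X = _](integral_torus_cst 0).
under [X in - X]eq_Rintegral do rewrite mulr1.
by move/eqP; rewrite eq_sym oppr_eq0 => /eqP.
Qed.

(** * The one-dimensional cell problem *)

Section CellProblem.
Variables K u du : R -> R.
Hypotheses (K_gt0 : forall t, 0 < K t) (K_cont : continuous K) (K_per : periodic K 1).
Hypothesis cell_du : cell_problem K u du.

Lemma cell_problem_integrable1 : mu.-integrable I01 (EFin \o (fun t => 1 + du t)).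
Proof.
have [[_ /L2_torus_integrable idu _] _] := cell_du.
apply: (@integrableD _ _ _ mu I01 _ (EFin \o cst 1) (EFin \o du)) => //.
exact/continuous_integrable01/cst_continuous.
Qed.

Lemma cell_problem_integrable : mu.-integrable I01 (EFin \o (fun t => (1 + du t) * K t)).
Proof.
under [X in _ \o X]eq_fun do rewrite mulrC.
exact: integrable01M_continuous K_cont cell_problem_integrable1.
Qed.

(** The right-hand side is the harmonic mean of [K], the classical homogenised coefficient in
    dimension one. A single test function, with derivative [1 / K - m], yields it. *)
Lemma cell_problem_flux :
  integral_torus (fun t => (1 + du t) * K t) = (integral_torus (fun t => (K t)^-1))^-1.
Proof.
have [[_ /L2_torus_integrable idu /integral_weak_derivative du0] testP] := cell_du.
have cV : continuous (fun t => (K t)^-1).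
  by move=> t; apply: cvgV; [rewrite gt_eqF | exact: K_cont].
have m0 : 0 < integral_torus (fun t => (K t)^-1).
  by apply: integral_torus_gt0 => // t; rewrite invr_gt0.
set m := integral_torus (fun t => (K t)^-1) in m0 *.
have [||/=|phi phiH] := @H1_torus_primitive (fun t => (K t)^-1 - m).
- by move=> t; apply: cvgB; [exact: cV | exact: cvg_cst].
- by move=> t; rewrite K_per.
- rewrite /integral_torus RintegralB//; last 2 first.
    exact: continuous_integrable01.
    exact/continuous_integrable01/cst_continuous.
  by rewrite [X in _ - X](integral_torus_cst m) subrr.
have := testP _ _ phiH; rewrite /integral_torus.
(* The integrand [K (du + 1) (1 / K - m)] expands to a difference whose integral is 1 minus [m]
   times the flux. *)
under eq_Rintegral => t _.
  rewrite (_ : _ * _ = (1 + du t) - m * ((1 + du t) * K t)); last first.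
    by field; rewrite gt_eqF.
  over.
have iK := cell_problem_integrable.
rewrite RintegralB//; first last.
- exact: (@integrable01M_continuous _ (cst m) (@cst_continuous _ _ m) iK).
- exact: cell_problem_integrable1.
rewrite RintegralZl// RintegralD//; last first.
  exact/continuous_integrable01/cst_continuous.
rewrite [X in X + _ - _](integral_torus_cst 1) [X in _ + X - _]du0 addr0.
move/eqP; rewrite subr_eq0 => /eqP m1.
by apply: (mulfI (lt0r_neq0 m0)); rewrite -m1 divff// lt0r_neq0.
Qed.

End CellProblem.

End TorusIntegral.

(** * Coordinates and iterated integrals *)

Lemma cvg_mx (T : topologicalType) (U : Type) (F : set_system U) (FF : Filter F)
    (m n : nat) (f : U -> 'M[T]_(m, n)) (M : 'M[T]_(m, n)) :
  (forall i j, f x i j @[x --> F] --> M i j) -> f x @[x --> F] --> M.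
Proof.
move=> fM A [P MP PA]; apply: (@filterS _ F FF (fun x => forall i j, P i j (f x i j))).
  by move=> x Px; apply: PA => i j; exact: Px.
apply: filter_forall => i; apply: filter_forall => j; exact: fM (MP i j).
Qed.

Section IteratedIntegral.
Variables (R : realType) (N : nat).
Implicit Types (x y : 'rV[R]_N.+1) (f c : 'rV[R]_N.+1 -> R) (s : seq nat) (k : nat).

Lemma coordinate_set_coordinate x k t : (k <= N)%N ->
  coordinate (set_coordinate x k t) k = t.
Proof. by move=> kN; rewrite /coordinate mxE inordK ?ltnS// eqxx. Qed.

Lemma coordinate_set_coordinate_neq x j k t : (j <= N)%N -> j != k ->
  coordinate (set_coordinate x k t) j = coordinate x j.
Proof. by move=> jN jk; rewrite /coordinate mxE inordK ?ltnS// (negbTE jk). Qed.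

Lemma first_coordinates_set_coordinate x j k t : (j <= N)%N -> (j <= k)%N ->
  first_coordinates j (set_coordinate x k t) = first_coordinates j x.
Proof.
move=> jN jk; apply/rowP => i; rewrite !mxE coordinate_set_coordinate_neq//.
  by rewrite (leq_trans _ jN)// ltnW.
by rewrite ltn_eqF// (leq_trans (ltn_ord i)).
Qed.

Lemma set_coordinateC x j k (u t : R) : j != k ->
  set_coordinate (set_coordinate x j u) k t = set_coordinate (set_coordinate x k t) j u.
Proof.
move=> jk; apply/rowP => i; rewrite !mxE; have [->|//] := eqVneq (i : nat) k.
by rewrite eq_sym (negbTE jk).
Qed.

(** Turns the invariance in [torus_fun], under translation by a basis vector, into periodicity of
    the one-variable slices. *)
Lemma set_coordinate_shift x (i : 'I_N.+1) t :
  set_coordinate x i (t + 1) = set_coordinate x i t + delta_mx 0 i.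
Proof.
apply/rowP => j; rewrite !mxE eqxx /=.
by case: eqVneq => [/val_inj ->|ji]; rewrite ?eqxx//= -val_eqE (negbTE ji) addr0.
Qed.

Lemma set_coordinateD_delta x (i : 'I_N.+1) k t :
  set_coordinate (x + delta_mx 0 i) k t =
  if k == i then set_coordinate x k t else set_coordinate x k t + delta_mx 0 i.
Proof.
case: eqVneq => [->|ki]; apply/rowP => j; rewrite !mxE eqxx/=.
  by case: eqVneq => // ji; rewrite -val_eqE (negbTE ji) addr0.
by case: eqVneq => // jk; rewrite -val_eqE /= jk (negbTE ki) addr0.
Qed.

(** Continuity is joint in the point and the new value, as [continuous_integral_torus] requires. *)
Lemma continuous_set_coordinate k :
  continuous (fun z : 'rV[R]_N.+1 * R => set_coordinate z.1 k z.2).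
Proof.
move=> z; apply: cvg_mx => i j.
under eq_fun do rewrite mxE; rewrite mxE.
case: ifP => _; first exact: cvg_snd.
apply: (@cvg_comp _ _ _ fst (fun x => x 0 j)); first exact: cvg_fst.
exact: coord_continuous.
Qed.

Lemma continuous_set_coordinatel x k : continuous (fun t => set_coordinate x k t).
Proof. exact: (continuous_pairl _ _ _ _ x (@continuous_set_coordinate k)). Qed.

Lemma continuous_comp_set_coordinate f x k : continuous f ->
  continuous (fun t => f (set_coordinate x k t)).
Proof.
move=> cf t; apply: (@cvg_comp _ _ _ _ f); last exact: cf.
exact: continuous_set_coordinatel.
Qed.

Lemma continuous_iter_integral s f : continuous f -> continuous (iter_integral s f).
Proof.
move=> cf; elim: s => //= k s IH.
apply: (continuous_integral_torus _ _
  (fun z => iter_integral s f (set_coordinate z.1 k z.2))).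
move=> z; apply: (@cvg_comp _ _ _ _ (iter_integral s f)); last exact: IH.
exact: continuous_set_coordinate.
Qed.

Lemma iter_integral_gt0 s f x : continuous f -> (forall y, 0 < f y) ->
  0 < iter_integral s f x.
Proof.
move=> cf f0; elim: s x => //= k s IH x; apply: integral_torus_gt0 => //.
by apply: continuous_comp_set_coordinate; exact: continuous_iter_integral.
Qed.

Lemma torus_fun_iter_integral s f : torus_fun f -> torus_fun (iter_integral s f).
Proof.
move=> fP; elim: s => //= k s IH i i0 x; congr integral_torus; apply/funext => t.
(* A shift in the variable being integrated is overwritten; any other shift is left to the induction
   hypothesis. *)
by rewrite set_coordinateD_delta; case: ifP => // _; exact: IH.
Qed.

Lemma iter_integralMl s f c x : continuous f ->
  (forall y k t, k \in s -> c (set_coordinate y k t) = c y) ->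
  iter_integral s (fun y => c y * f y) x = c x * iter_integral s f x.
Proof.
move=> cf; elim: s x => //= k s IH x cs.
rewrite -[RHS]RintegralZl//; last first.
  by apply/continuous_integrable01/continuous_comp_set_coordinate/continuous_iter_integral.
congr integral_torus; apply/funext => t; rewrite IH ?cs ?inE ?eqxx//.
by move=> y j u js; apply: cs; rewrite inE js orbT.
Qed.

(** * Order of integration *)

Section Exchange.
Variable f : 'rV[R]_N.+1 -> R.
Hypotheses (f_cont : continuous f) (f_gt0 : forall y, 0 < f y).

(** Fubini's theorem for the positive continuous function [g], together with the fact that
    overwriting two distinct coordinates commutes. *)
Lemma iter_integral_swap s j k : j != k ->
  iter_integral [:: j, k & s] f = iter_integral [:: k, j & s] f.
Proof.
move=> jk; apply/funext => x /=.
set g := iter_integral s f.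
have cg : continuous g by exact: continuous_iter_integral.
rewrite (integral_torus_fubini _
  (fun z => g (set_coordinate (set_coordinate x j z.1) k z.2)))/=.
- congr integral_torus; apply/funext => t; congr integral_torus; apply/funext => u.
  by rewrite set_coordinateC.
- move=> z; apply: (@cvg_comp _ _ _ _ g); last exact: cg.
  apply: (@cvg_comp _ _ _ (fun z : R * R => (set_coordinate x j z.1, z.2))
    (fun w : 'rV[R]_N.+1 * R => set_coordinate w.1 k w.2)); last first.
    exact: (@continuous_set_coordinate k (set_coordinate x j z.1, z.2)).
  have cj : set_coordinate x j z'.1 @[z' --> z] --> set_coordinate x j z.1.
    apply: (@cvg_comp _ _ _ fst (set_coordinate x j)); first exact: cvg_fst.
    exact: continuous_set_coordinatel.
  exact: (cvg_pair cj (cvg_snd (F := nbhs z.1) (G := nbhs z.2))).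
- by move=> z; rewrite ltW// iter_integral_gt0.
Qed.

(** The innermost variable [k] is carried to the outermost place by successive exchanges with its
    outer neighbour. *)
Lemma iter_integral_rcons s k : k \notin s ->
  iter_integral (rcons s k) f = iter_integral (k :: s) f.
Proof.
elim: s => //= j s IH; rewrite inE negb_or => /andP[kj ks].
by rewrite (IH ks) -[RHS]/(iter_integral [:: k, j & s] f) iter_integral_swap.
Qed.

Lemma iter_integral_rev s : uniq s -> iter_integral (rev s) f = iter_integral s f.
Proof.
elim: s => //= k s IH /andP[ks us].
by rewrite rev_cons iter_integral_rcons ?mem_rev//= IH.
Qed.

End Exchange.

End IteratedIntegral.

(** * Descending induction over the scales *)

Section EffectiveDiffusion.
Variables (R : realType) (N : nat) (sigma : R) (V : 'rV[R]_N.+1 -> R).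
Variables theta dtheta : forall k : nat, 'rV[R]_k -> R -> R.
Hypotheses (V_cont : continuous V) (V_torus : torus_fun V).
Hypothesis theta_sol : corrector_family sigma V dtheta theta.

Lemma continuous_expR_div (W : 'rV[R]_N.+1 -> R) :
  continuous W -> continuous (fun y => expR (W y / sigma)).
Proof.
move=> cW y; apply: (@cvg_comp _ _ _ (fun y => W y / sigma) expR);
  last exact: continuous_expR.
exact: (cvgM (cW y) (cvg_cst sigma^-1)).
Qed.

(** For [n + m = N] this turns out to be the reciprocal of [calK n]. It involves no corrector, so
    its continuity and positivity are immediate. *)
Let J n m := iter_integral (iota n.+1 m) (fun y => expR (V y / sigma)).

(** Induction on the number [m] of integrated variables. The factors [1 + dtheta j] left inside need
    not be continuous, so [iter_integralMl] does not apply; the weight [c], free of the integrated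
    variables, collects the factors already taken out. *)
Lemma iter_integral_calK m n (c : 'rV[R]_N.+1 -> R) x : (n + m)%N = N ->
  (forall y k t, (n < k)%N -> c (set_coordinate y k t) = c y) ->
  iter_integral (iota n.+1 m) (fun y => c y *
    ((\prod_(n.+1 <= j < N.+1)
       (1 + dtheta j (first_coordinates j y) (coordinate y j))) *
    expR (- V y / sigma))) x = c x / J n m x.
Proof.
elim: m n c x => [|m IH] n c x nmN cn.
  (* Here [n = N]: the product is empty and [exp (- V / sigma)] is the reciprocal of [J]. *)
  by rewrite /J/= big_geq ?mul1r ?mulNr ?expRN// ltnS -nmN addn0.
have nmN1 : (n.+1 + m)%N = N by rewrite addSnnS.
have nN : (n < N)%N by rewrite -nmN addnS ltnS leq_addr.
rewrite /J/=.
(* Weight 1 in the induction hypothesis identifies the coefficient of the next cell problem. *)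
have calKE y : calK sigma V dtheta n.+1 y = (J n.+1 m y)^-1.
  rewrite -[RHS]mul1r -(IH n.+1 (fun=> 1))// /calK.
  rewrite (_ : (N - n.+1)%N = m); last by rewrite -nmN1 addKn.
  congr (iter_integral _ _ y); apply/funext => z; by rewrite mul1r.
have [_ _ /(_ x) cell] := theta_sol n.+1 nN.
pose K t := calK sigma V dtheta n.+1 (set_coordinate x n.+1 t).
have cJ : continuous (J n.+1 m).
  exact/continuous_iter_integral/continuous_expR_div.
have J0 y : 0 < J n.+1 m y.
  by apply: iter_integral_gt0 => [|z]; [exact: continuous_expR_div|exact: expR_gt0].
have KE : K = fun t => (J n.+1 m (set_coordinate x n.+1 t))^-1.
  by apply/funext => t; exact: calKE.
have K0 t : 0 < K t by rewrite KE invr_gt0.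
have cK : continuous K.
  rewrite KE => t; apply: cvgV; first by rewrite gt_eqF.
  exact: continuous_comp_set_coordinate.
have pK : periodic K 1.
  move=> t; rewrite KE; congr _^-1.
  have := set_coordinate_shift R N x (inord n.+1) t; rewrite inordK ?ltnS// => ->.
  apply: torus_fun_iter_integral; last by rewrite inordK.
  by move=> i i0 y; rewrite V_torus.
(* With the inner integrals in this form, the outer one is [c x] times the flux, and the mean of
   [1 / K] is exactly [J n m.+1 x]. *)
rewrite (_ : (fun t => _) =
    (fun t => c x * ((1 + dtheta n.+1 (first_coordinates n.+1 x) t) * K t))).
  rewrite /integral_torus RintegralZl//; last exact: cell_problem_integrable cell.
  congr (_ * _); rewrite [LHS](cell_problem_flux _ _ _ _ _ _ _ cell)//.
  by congr (_ ^-1); congr integral_torus; apply/funext => t; rewrite calKE invrK.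
apply/funext => t; rewrite KE mulrA.
(* At a fixed value of [x_(n+1)], the factor [1 + dtheta n.+1] joins the weight, and the induction
   hypothesis is applied to [c']. *)
pose c' y := c y * (1 + dtheta n.+1 (first_coordinates n.+1 y) (coordinate y n.+1)).
transitivity
  (c' (set_coordinate x n.+1 t) / J n.+1 m (set_coordinate x n.+1 t)); last first.
  by rewrite /c' cn// first_coordinates_set_coordinate// coordinate_set_coordinate.
rewrite -IH//.
  congr (iter_integral _ _ _); apply/funext => y.
  by rewrite big_ltn ?ltnS// /c' !mulrA.
move=> y k u nk; rewrite /c' cn; last exact: ltn_trans nk.
by rewrite first_coordinates_set_coordinate ?(ltnW nk)//
  coordinate_set_coordinate_neq// ltn_eqF.
Qed.

(** The case [n = 0], [m = N] with weight 1 evaluates the numerator [calK 0]. *)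
Lemma effective_diffusionE x : effective_diffusion sigma V dtheta x =
  1 / (iter_integral (iota 1 N) (fun y => expR (- V y / sigma)) (const_mx x) *
       iter_integral (iota 1 N) (fun y => expR (V y / sigma)) (const_mx x)).
Proof.
rewrite /effective_diffusion /partition_fun /calK subn0.
have := iter_integral_calK N 0 (fun=> 1) (const_mx x) (add0n N) (fun _ _ _ _ => erefl).
under [X in iter_integral _ X]eq_fun do rewrite mul1r.
by move=> ->; rewrite /J invfM mulrCA mulrC mul1r.
Qed.

End EffectiveDiffusion.

(** * Separation of the macroscopic potential *)

Lemma iter_integral_expR_split (R : realType) (N : nat) (sigma : R) (U0 : R -> R)
    (U U1 : 'rV[R]_N.+1 -> R) (x : R) : continuous U1 ->
  (forall y, U y = U0 (coordinate y 0) + U1 y) ->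
  iter_integral (iota 1 N) (fun y => expR (U y / sigma)) (const_mx x) =
  expR (U0 x / sigma) *
  iter_integral (rev (iota 1 N)) (fun y => expR (U1 y / sigma)) (const_mx x).
Proof.
move=> cU1 UE.
rewrite iter_integral_rev ?iota_uniq//; last first.
- by move=> y; exact: expR_gt0.
- exact: continuous_expR_div.
(* This factor depends on [x_0] only, and the integrated variables have index at least 1, so it
   comes out of the integrals. *)
pose c (y : 'rV[R]_N.+1) := expR (U0 (coordinate y 0) / sigma).
have -> : expR (U0 x / sigma) = c (const_mx x) by rewrite /c /coordinate mxE.
rewrite -(iter_integralMl _ _ _ _ c)//.
- by congr (iter_integral _ _ _); apply/funext => y; rewrite UE mulrDl expRD.
- exact: continuous_expR_div.
- move=> y k t; rewrite mem_iota => /andP[k0 _].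
  by rewrite /c coordinate_set_coordinate_neq// eq_sym -lt0n.
Qed.

Theorem proposition2p4 (R : realType) (N : nat) (sigma : R)
    (V : 'rV[R]_N.+1 -> R) (V0 : R -> R) (V1 : 'rV[R]_N.+1 -> R)
    (theta dtheta : forall k : nat, 'rV[R]_k -> R -> R)
    (N_ge1 : (1 <= N)%N) (sigma_gt0 : 0 < sigma)
    (V_smooth : smooth V) (V_torus : torus_fun V)
    (V_split : forall x, V x = V0 (coordinate x 0) + V1 x)
    (V0_smooth : smooth V0)
    (V0_L1 : (@lebesgue_measure R).-integrable setT
               (fun x => (expR (- V0 x))%:E))
    (V0_pinfty : V0 x @[x --> +oo] --> +oo)
    (V0_ninfty : V0 x @[x --> -oo] --> +oo)
    (V0_bounded2 : bounded_fun ((V0^`(2))%classic))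
    (V1_smooth : smooth V1) (V1_torus : torus_fun V1)
    (V1_bounded : bounded_fun V1)
    (theta_sol : corrector_family sigma V dtheta theta) :
  forall x : R,
    effective_diffusion sigma V dtheta x =
    1 / (Z1 sigma V1 x * Z1hat sigma V1 x).
Proof.
move=> x; have [V_cont _] := V_smooth [::]; have [V1_cont _] := V1_smooth [::].
rewrite (effective_diffusionE _ _ _ _ theta)// /Z1 /Z1hat.
rewrite (iter_integral_expR_split _ _ _ V0 _ V1)//.
(* The same splitting with all signs reversed handles the partition function; its [V0] factor is the
   inverse of the previous one. *)
rewrite (iter_integral_expR_split _ _ _ (fun t => - V0 t) _ (fun y => - V1 y)).
- by rewrite mulNr expRN mulrACA mulVf ?mul1r// gt_eqF ?expR_gt0.
- by move=> y; exact: (cvgN (V1_cont y)).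
- by move=> y; rewrite V_split opprD.
Qed.
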